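(* For all sufficiently large $n$, $$\log k(n)\leqslant \frac{2\log n}{\log\log n}.$$ Moreover, if $n$ is sufficiently large and of the form $n=(2\uparrow\uparrow m)^{2\uparrow\uparrow(m-1)}$ with $m\geqslant 2$, then $\log k(n)\leqslant\sqrt{\log n}$.
   Context: For $n\ge1$ let $t(n)$ be the rooted planar tree of $n$: $t(1)$ is the single-vertex tree; if $n=p_1^{a_1}\cdots p_s^{a_s}$ with primes $p_1<\dots<p_s$, $a_i\ge1$, then $t(n)$ is a root with $s$ ordered edges, the $i$-th leading to a copy of $t(a_i)$. Let $t^\#(n)$ be the corresponding nonplanar rooted tree (isomorphism class of rooted trees, forgetting the left-to-right order). For $n\ge1$, $k(n)=\max\{k\ge1: t^\#(n+1)=t^\#(n+2)=\cdots=t^\#(n+k)\}$. Tetration: $2\uparrow\uparrow1=2$, $2\uparrow\uparrow(m+1)=2^{2\uparrow\uparrow m}$. *)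

(* Defs.v *)
From mathcomp Require Import all_boot all_order all_algebra.
From mathcomp Require Import all_classical all_reals all_analysis.

Set Implicit Arguments.
Unset Strict Implicit.
Unset Printing Implicit Defensive.

Inductive ptree : Type := PNode of seq ptree.

Definition subtrees (T : ptree) : seq ptree := let: PNode s := T in s.

(* The fuel only serves termination: every exponent [logn p n] is < n, so fuel
   n is enough; [tplE] below is the defining equation. *)
Fixpoint tpl_rec (fuel n : nat) : ptree :=
  if fuel is fuel'.+1 then PNode [seq tpl_rec fuel' (logn p n) | p <- primes n]
  else PNode [::].

(* The planar tree t(n), for n >= 1 (t(0), never used, is the one-vertex tree).
   [primes n] lists the prime divisors of n in increasing order. *)
Definition tpl (n : nat) : ptree := tpl_rec n n.

Lemma tpl_rec_fuel f g n : n <= f -> n <= g -> tpl_rec f n = tpl_rec g n.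
Proof.
elim: f g n => [|f IH] [|g] n //=; rewrite ?leqn0.
- by move=> /eqP -> _.
- by move=> _ /eqP ->.
move=> nf ng; congr PNode; apply/eq_in_map => p.
rewrite mem_primes => /and3P[pp n0 _].
have ln : logn p n < n by rewrite ltn_logl.
by apply: IH; rewrite -ltnS; apply: leq_trans ln _.
Qed.

Lemma tplE n : tpl n = PNode [seq tpl (logn p n) | p <- primes n].
Proof.
case: n => [|n] //; rewrite /tpl /=; congr PNode; apply/eq_in_map => p _.
by apply: tpl_rec_fuel; rewrite // -ltnS ltn_logl.
Qed.

(* A vertex is encoded by the sequence of edge positions leading to it from the
   root, the root itself being [::]. *)
Fixpoint is_vertex (T : ptree) (a : seq nat) : bool :=
  if a is i :: a' then
    if onth (subtrees T) i is Some U then is_vertex U a' else false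
  else true.

Notation vertex T := {a : seq nat | is_vertex T a}.

Definition troot (T : ptree) : vertex T := exist _ [::] isT.

Definition adjacent (T : ptree) (u v : vertex T) : Prop :=
  (exists i, val v = rcons (val u) i) \/ (exists i, val u = rcons (val v) i).

Definition rooted_iso (T U : ptree) : Prop :=
  exists f : vertex T -> vertex U,
    [/\ bijective f, f (troot T) = troot U
      & forall u v, adjacent u v <-> adjacent (f u) (f v)].

(* The nonplanar tree t^#(n): the isomorphism class of t(n) as a rooted tree. *)
Definition tsharp (n : nat) : set ptree := [set U | rooted_iso (tpl n) U]%classic.

Definition tsharp_run (n k : nat) : Prop :=
  forall i, 1 <= i <= k -> tsharp (n + i) = tsharp (n + 1).

Definition tsharp_runb (n k : nat) : bool := (1 <= k) && `[< tsharp_run n k >].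

Lemma rooted_iso_refl T : rooted_iso T T.
Proof. by exists id; split => //; exists id. Qed.

Lemma tsharp_iso m n : tsharp m = tsharp n -> rooted_iso (tpl m) (tpl n).
Proof.
by move=> e; have : tsharp n (tpl n) := rooted_iso_refl _; rewrite -e.
Qed.

Lemma is_vertex_prime p a :
  prime p -> is_vertex (tpl p) a -> a \in [:: [::]; [:: 0]].
Proof.
move=> pp; rewrite tplE primes_prime //= logn_prime // eqxx.
by case: a => [|[|i] a] //=; [case: a => [|j a] //=; case: j | case: i].
Qed.

Lemma three_vertices n : 1 < n -> ~~ prime n ->
  exists a b, [/\ is_vertex (tpl n) a, is_vertex (tpl n) b & uniq [:: [::]; a; b]].
Proof.
move=> n1 npr; have n0 := ltnW n1.
case E: (primes n) => [|p [|q s]].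
- by move/eqP: E; rewrite primes_eq0; case: n n1 {npr n0} => [|[]].
- have pp : p \in primes n by rewrite E inE.
  move: (pp); rewrite mem_primes => /and3P[pr _ _].
  exists [:: 0], [:: 0; 0]; split => //; first by rewrite tplE E.
  rewrite tplE E /= tplE.
  case E2: (primes (logn p n)) => [|r t] //=; exfalso.
  move/eqP: E2; rewrite primes_eq0 => l2.
  have l0 : 0 < logn p n by rewrite logn_gt0.
  have l1 : logn p n = 1 by move: l0 l2; case: (logn p n) => [|[]].
  have := prod_prime_decomp n0; rewrite prime_decompE E big_seq1 /= l1 => e.
  by move: npr; rewrite e expn1 pr.
- by exists [:: 0], [:: 1]; split => //; rewrite tplE E.
Qed.

Lemma tsharp_prime_neq p n :
  prime p -> 1 < n -> ~~ prime n -> tsharp p <> tsharp n.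
Proof.
move=> pp n1 npr /esym /tsharp_iso [f [/bij_inj finj _ _]].
have [a [b [va vb]]] := three_vertices n1 npr.
pose us : seq (vertex (tpl n)) := [:: troot _; exist _ a va; exist _ b vb].
move=> u3; have uus : uniq us by rewrite -(map_inj_uniq val_inj).
have : uniq [seq val (f u) | u <- us].
  by rewrite map_inj_uniq // => x y /val_inj/finj.
move=> uf; have H := @uniq_leq_size _ _ [:: [::]; [:: 0]] uf.
suff : 3 <= 2 by [].
by apply: H => c /mapP[u _ ->]; apply: (is_vertex_prime pp); exact: (valP (f u)).
Qed.

Lemma tsharp_run_ex n : exists k, tsharp_runb n k.
Proof.
exists 1; apply/andP; split=> //; apply/asboolP => i.
by rewrite -eqn_leq => /eqP <-.
Qed.

(* A run cannot contain an odd prime together with its successor. *)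
Lemma tsharp_run_bounded n : {b | forall k, tsharp_runb n k -> k <= b}.
Proof.
have [p np pp] := prime_above n.+2; exists (p - n) => k /andP[_ /asboolP run].
rewrite leqNgt; apply/negP => lt.
have le_np : n <= p by apply: ltnW; apply: ltn_trans np; rewrite ltnS leqW.
have p2 : 2 < p by apply: leq_trans np; rewrite !ltnS.
have pn0 : 0 < p - n by rewrite subn_gt0; apply: ltn_trans np; rewrite ltnS leqW.
have np1 : ~~ prime p.+1.
  apply/negP => /even_prime[e|]; first by move: p2; rewrite -ltnS e.
  by have [e|op] := even_prime pp; [rewrite e in p2 | rewrite /= op].
have e1 := run (p - n); have e2 := run (p - n).+1.
rewrite addnS subnKC // in e2; rewrite subnKC // in e1.
apply: (@tsharp_prime_neq p p.+1) => //; first by rewrite ltnS prime_gt0.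
by rewrite e1 ?e2 // pn0 ltnW.
Qed.

(* k(n) = max {k >= 1 : t^#(n+1) = ... = t^#(n+k)} *)
Definition kmax (n : nat) : nat :=
  ex_maxn (tsharp_run_ex n) (svalP (tsharp_run_bounded n)).

Lemma kmaxP n : [/\ 1 <= kmax n, tsharp_run n (kmax n)
  & forall k, 1 <= k -> tsharp_run n k -> k <= kmax n].
Proof.
rewrite /kmax; case: ex_maxnP => k /andP[k1 /asboolP rk] mx; split => // l l1 rl.
by apply: mx; rewrite /tsharp_runb l1; apply/asboolP.
Qed.

(* 2 ^^ m; the value 1 at m = 0 yields 2 ^^ 1 = 2. *)
Fixpoint tetr2 (m : nat) : nat := if m is m'.+1 then 2 ^ tetr2 m' else 1.

(* Main.v *)
(* The height of t(n) is an isomorphism invariant, and height j forces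
   n >= 2 ^^ j.  Let k = k(n) and b = 2 ^^ j.  If 2^(b+1) <= k, some n+i has
   2-adic valuation exactly b, so its tree has height at least j+1; hence so
   does the tree of every n+i with i <= k, and every such n+i is divisible by
   p^b for some prime p.  At most sum_d (k/d^b + 1) of the n+i are divisible by
   some d^b, and only d <= (n+k)^(1/b) matter, so k/2 <= (n+k)^(1/b), which
   gives k^b <= 2^(b+1) n.  Taking the largest such b yields b > log_2(log_2 k - 1)
   and the first bound; taking b = 2 ^^ (m-1) yields the second one. *)
Require Import Defs.
From mathcomp Require Import all_boot all_order all_algebra.
From mathcomp Require Import all_classical all_reals all_analysis.
From mathcomp Require Import zify ring lra.
Import Order.TTheory GRing.Theory Num.Theory.

Set Implicit Arguments.
Unset Strict Implicit.
Unset Printing Implicit Defensive.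

(** * Depth of rooted trees as an isomorphism invariant *)

Definition has_depth (T : ptree) (d : nat) : Prop :=
  exists2 a, is_vertex T a & size a = d.

Lemma is_vertex_rcons T a i : is_vertex T (rcons a i) -> is_vertex T a.
Proof.
elim: a T => [|j a IH] T //=.
by case: (onth _ _) => // U; apply: IH.
Qed.

(** Induction along the path from the root: each edge raises the level of the image by at most one.
    Applied to an isomorphism and to its inverse, this gives equality of levels. *)
Lemma rooted_iso_depth_le T U (f : vertex T -> vertex U) :
  f (troot T) = troot U ->
  (forall u v, Defs.adjacent u v -> Defs.adjacent (f u) (f v)) ->
  forall u, size (val (f u)) <= size (val u).
Proof.
move=> f0 fadj [a va] /=.
elim/last_ind: a va => [|a i IH] va.
  rewrite (_ : exist _ _ _ = troot T) ?f0 //; exact: val_inj.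
have va' := is_vertex_rcons va.
have /fadj : Defs.adjacent (exist _ a va' : vertex T) (exist _ (rcons a i) va : vertex T) by left; exists i.
have := IH va'; rewrite size_rcons /Defs.adjacent.
by move=> le [] [j /(congr1 size)]; rewrite size_rcons /= => e; lia.
Qed.

Lemma rooted_iso_depth T U d : rooted_iso T U -> has_depth T d -> has_depth U d.
Proof.
move=> [f [[g fK gK] f0 fadj]] [a va sa].
have fle := rooted_iso_depth_le f0 (fun u v => proj1 (fadj u v)).
have g0 : g (troot U) = troot T by rewrite -f0 fK.
have gadj u v : Defs.adjacent u v -> Defs.adjacent (g u) (g v).
  by move=> uv; apply/fadj; rewrite !gK.
have gle := rooted_iso_depth_le g0 gadj.
pose u : vertex T := exist _ a va.
exists (val (f u)); first exact: valP.
apply/eqP; rewrite eqn_leq -sa (fle u) /=.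
by have := gle (f u); rewrite fK.
Qed.

(** * Depth of [tpl n] and tetration *)

Lemma has_depth_tplS p n d : p \in primes n ->
  has_depth (tpl (logn p n)) d -> has_depth (tpl n) d.+1.
Proof.
move=> pn [a va <-]; exists (index p (primes n) :: a) => //=.
by rewrite tplE /= onth_map onthE (nth_map 0) ?index_mem //= nth_index.
Qed.

Lemma has_depth_tplS_inv n d : has_depth (tpl n) d.+1 ->
  exists2 p, p \in primes n & has_depth (tpl (logn p n)) d.
Proof.
case=> [[|i a]] //; rewrite tplE /= onth_map.
case: (ltnP i (size (primes n))) => ltis; last by rewrite onth_default.
rewrite onthE (nth_map 0) //= => va [sa].
by exists (nth 0 (primes n) i); [exact: mem_nth | exists a].
Qed.

Lemma tetr2_gt0 j : 0 < tetr2 j.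
Proof. by case: j => //= j; rewrite expn_gt0. Qed.

Lemma tetr2_ge j : j < tetr2 j.
Proof. by elim: j => //= j IH; apply: leq_ltn_trans IH (ltn_expl _ _). Qed.

Lemma tetr2_ge4 j : 1 < j -> 4 <= tetr2 j.
Proof.
case: j => [|[|j]] // _ /=.
by rewrite (@leq_exp2l 2 2) // (@leq_exp2l 2 1) // tetr2_gt0.
Qed.

Lemma has_depth_tetr2 j : has_depth (tpl (tetr2 j)) j.
Proof.
elim: j => [|j IH]; first by exists [::].
apply: (@has_depth_tplS 2); last by rewrite /= pfactorK.
by rewrite /= primesX ?tetr2_gt0.
Qed.

(** Each level down passes to the exponent of a prime, and that prime is at least 2, so every level
    costs one exponential. *)
Lemma tetr2_le_has_depth j n : 0 < n -> has_depth (tpl n) j -> tetr2 j <= n.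
Proof.
elim: j n => [|j IH] n n0 // /has_depth_tplS_inv [p pn].
move: (pn); rewrite -logn_gt0 => l0 /(IH _ l0) le /=.
have := pn; rewrite mem_primes => /and3P[pp _ _].
apply: leq_trans (dvdn_leq n0 (pfactor_dvdnn p n)).
apply: leq_trans (leq_pexp2l _ le) _ => //.
by rewrite leq_exp2r // prime_gt1.
Qed.

Lemma tetr2_dvdn_has_depth j n : has_depth (tpl n) j.+1 ->
  exists2 p, prime p & p ^ tetr2 j %| n.
Proof.
move=> /has_depth_tplS_inv [p pn].
move: (pn); rewrite -logn_gt0 => l0 /(tetr2_le_has_depth l0) le.
move: pn; rewrite mem_primes => /and3P[pp n0 _].
by exists p => //; rewrite pfactor_dvdn.
Qed.

(** * High prime powers dividing every term of a run *)

Lemma exists_logn2_eq n k b : 2 ^ b.+1 <= k ->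
  exists2 i, 1 <= i <= k & logn 2 (n + i) = b.
Proof.
move=> kb; pose q := 2 ^ b; have q0 : 0 < q by rewrite expn_gt0.
have kq : 2 * q <= k by rewrite -expnS.
pose u := (n + q) %/ (2 * q).
have := divn_eq (n + q) (2 * q); rewrite -/u.
have := @ltn_pmod (n + q) (2 * q); set r := _ %% _ => rlt e.
have {}rlt : r < 2 * q by apply: rlt; lia.
(* Since n + q = 2qu + r, this choice gives n + i = q(2u + 1), an odd multiple of q = 2^b. *)
exists (2 * q - r); first lia.
have -> : n + (2 * q - r) = q * (u.*2.+1) by nia.
by rewrite lognM // pfactorK // lognE dvdn2 /= odd_double /= addn0.
Qed.

Lemma kmax_pow_dvdn n j i : 2 ^ (tetr2 j).+1 <= kmax n -> 1 <= i <= kmax n ->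
  exists2 p, prime p & p ^ tetr2 j %| n + i.
Proof.
move=> kb ik; have [_ run _] := kmaxP n.
have [i0 i0k e] := exists_logn2_eq n kb.
apply: tetr2_dvdn_has_depth.
have iso : rooted_iso (tpl (n + i0)) (tpl (n + i)).
  by apply: tsharp_iso; rewrite !run.
(* The exponent of 2 in [n + i0] is [tetr2 j], whose tree has depth [j]; the edge for 2 adds one
   level. *)
apply: rooted_iso_depth iso _; apply: (@has_depth_tplS 2).
  by rewrite -logn_gt0 e tetr2_gt0.
by rewrite e; apply: has_depth_tetr2.
Qed.

(** * Counting multiples of b-th powers in an interval *)

(** The count is exactly floor((n + k)/q) - floor(n/q). *)
Lemma count_multiples_le q n k : 0 < q ->
  \sum_(i < k) (q %| n + i.+1) <= k %/ q + 1.
Proof.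
move=> q0; suff e : n %/ q + \sum_(i < k) (q %| n + i.+1) = (n + k) %/ q.
  by rewrite -(leq_add2l (n %/ q)) e addnA leq_divDl.
elim: k => [|k IH]; first by rewrite big_ord0 !addn0.
by rewrite big_ord_recr /= addnA IH addnS divnS // addnC.
Qed.

(* 1/d^3 <= (1/(d-1) - 1/d)/2, which telescopes. *)
Lemma sum_div_pow_le k b D : 2 < b ->
  (\sum_(2 <= d < D.+2) k %/ d ^ b).*2 <= k.
Proof.
move=> b2.
(* Keeping the term 1/(D + 1) lets the induction on [D] close. *)
suff : ((\sum_(2 <= d < D.+2) k %/ d ^ b)%:R <= k%:R / 2 * (1 - D.+1%:R^-1) :> rat)%R.
  move=> le; rewrite -(ler_nat rat) -muln2 natrM.
  have y0 : (0 <= k%:R / 2 * D.+1%:R^-1 :> rat)%R by rewrite !mulr_ge0 ?invr_ge0.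
  move: le; rewrite mulrBr mulr1; move: y0; set y := (_ * D.+1%:R^-1)%R; clearbody y.
  by move: (_%:R)%R (k%:R)%R => S z y0; lra.
elim: D => [|D IH]; first by rewrite big_geq // invr1 subrr mulr0.
rewrite big_nat_recr //= natrD.
have x0 : (0 < D.+1%:R :> rat)%R by rewrite ltr0n.
have k0 : (0 <= k%:R :> rat)%R by [].
have le1 : ((k %/ D.+2 ^ b)%:R <= k%:R / D.+2%:R ^+ 3 :> rat)%R.
  rewrite ler_pdivlMr ?exprn_gt0 // -natrX -natrM ler_nat.
  apply: leq_trans (leq_trunc_div k (D.+2 ^ b)).
  by rewrite leq_mul2l leq_exp2l // b2 orbT.
have le2 : (k%:R / D.+2%:R ^+ 3 <= k%:R / 2 * (D.+1%:R^-1 - D.+2%:R^-1) :> rat)%R.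
  rewrite -mulrA ler_wpM2l //.
  rewrite -[D.+2]addn1 natrD; set x := (D.+1%:R)%R in x0 *.
  have -> : (2^-1 * (x^-1 - (x + 1)^-1) = (2 * x * (x + 1))^-1 :> rat)%R.
    by field; apply/andP; split; lra.
  rewrite lef_pV2 ?posrE; first nra.
    by rewrite exprn_gt0; lra.
  by rewrite !mulr_gt0; lra.
apply: le_trans (lerD IH (le_trans le1 le2)) _.
by rewrite -mulrDr addrA subrK.
Qed.

(** If the bound failed, every prime involved would be less than k/2. Counting the terms by their
    divisors d^b would then give at most k/2 from the quotients plus fewer than k/2 from the
    rounding terms. *)
Lemma all_pow_dvdn_bound n k b : 2 < b ->
  (forall i, 1 <= i <= k -> exists2 p, prime p & p ^ b %| n + i) ->
  k ^ b <= 2 ^ b * (n + k).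
Proof.
move=> b2 H; rewrite leqNgt; apply/negP => lt.
case: k H lt => [|k] H lt; first by rewrite exp0n // in lt; lia.
(* The run length is now [k.+1], and [D] is the largest integer strictly below half of it. *)
pose D := k./2.
have Dk : k.+1 <= 2 * D.+1 by rewrite /D; lia.
have pD p i : i <= k.+1 -> 0 < n + i -> p ^ b %| n + i -> p <= D.
  move=> ik ni0 /(dvdn_leq ni0) le; rewrite leqNgt; apply/negP => Dp.
  have : D.+1 ^ b <= p ^ b by rewrite leq_exp2r //; lia.
  have : k.+1 ^ b <= (2 * D.+1) ^ b by rewrite leq_exp2r //; lia.
  rewrite expnMn => le2 le3.
  have : 2 ^ b * D.+1 ^ b <= 2 ^ b * (n + k.+1) by rewrite leq_mul2l; lia.
  lia.
(* Double counting: each term has at least one divisor d^b with 2 <= d <= D. A prime p <= D forces D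
   >= 2, so [D.-1.+2] is D + 1. *)
have : k.+1 <= \sum_(i < k.+1) \sum_(2 <= d < D.-1.+2) (d ^ b %| n + i.+1).
  rewrite -{1}[k.+1]card_ord -sum1_card; apply: leq_sum => i _.
  have [|p pp dv] := H i.+1; first by rewrite /= ltn_ord.
  have leD : p <= D by apply: pD dv; rewrite ?addnS.
  rewrite (bigD1_seq p) ?iota_uniq //= ?dv //.
  by rewrite mem_index_iota prime_gt1 //=; have := prime_gt1 pp; lia.
rewrite exchange_big /= => le.
have : k.+1 <= \sum_(2 <= d < D.-1.+2) (k.+1 %/ d ^ b + 1).
  apply: leq_trans le _; rewrite !big_nat; apply: leq_sum => d /andP[d2 _].
  by apply: count_multiples_le; rewrite expn_gt0; lia.
rewrite big_split /= sum_nat_const_nat muln1.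
have := sum_div_pow_le k.+1 D.-1 b2.
by rewrite /D; lia.
Qed.

(** * The resulting inequality for [kmax] and the choice of tower *)

Lemma kmax_exp_le n j : 1 < j -> 2 ^ (tetr2 j).+1 <= kmax n ->
  kmax n ^ tetr2 j <= 2 ^ (tetr2 j).+1 * n.
Proof.
move=> j1 kb; have b4 := tetr2_ge4 j1.
have := @all_pow_dvdn_bound n (kmax n) _ (ltnW b4) (fun i => kmax_pow_dvdn kb).
move: kb; set k := kmax n; move: (tetr2 j) b4 => b b4 kb le.
have k0 : 0 < k by apply: leq_trans kb; rewrite expn_gt0.
have kn : k <= n.
  (* Otherwise k^b <= 2^b (n + k) <= 2^(b+1) k <= k^2, against b >= 4. *)
  rewrite leqNgt; apply/negP => nk.
  have : k ^ b <= k * k.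
    apply: leq_trans le _; apply: leq_trans (_ : 2 ^ b.+1 * k <= _).
      by rewrite expnSr -mulnA leq_mul2l; lia.
    by rewrite leq_mul2r kb orbT.
  rewrite mulnn leq_exp2l; first lia.
  by apply: leq_trans kb; rewrite (@leq_exp2l 2 1).
apply: leq_trans le _.
by rewrite expnSr -mulnA leq_mul2l; lia.
Qed.

(** Take the largest admissible [j]; the upper bound is the failure at [j.+1]. The threshold 2^5 is
    the case j = 2, where the tower is 4. *)
Lemma exists_tetr2_floor k : 2 ^ 5 <= k ->
  exists2 j, 1 < j & 2 ^ (tetr2 j).+1 <= k < 2 ^ (2 ^ tetr2 j).+1.
Proof.
move=> k5; pose P j := 2 ^ (tetr2 j).+1 <= k.
have ubP j : P j -> j <= k.
  move=> Pj; apply: leq_trans (ltnW (tetr2_ge j)) _; apply: leq_trans Pj.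
  exact: ltnW (ltnW (ltn_expl _ _)).
have exP : exists j, P j by exists 2.
case: (ex_maxnP exP ubP) => j Pj mx; exists j; first exact: (mx 2).
apply/andP; split; first exact: Pj.
rewrite ltnNge; apply/negP => PSj.
by have := mx j.+1 PSj; rewrite ltnn.
Qed.

(** * Logarithmic estimates and the two asymptotic bounds *)

Local Open Scope ring_scope.

Lemma ln2_lt1 (R : realType) : ln 2 < 1 :> R.
Proof.
rewrite -[X in _ < X]expRK ltr_ln ?posrE ?expR_gt0 //.
by have := @expR_gt1Dx R 1 (oner_neq0 _); lra.
Qed.

Lemma ln2_gt0 (R : realType) : 0 < ln 2 :> R.
Proof. by rewrite ln_gt0 // ltr1n. Qed.

Lemma ln_natX (R : realType) (a e : nat) : (0 < a)%N ->
  ln ((a ^ e)%:R : R) = e%:R * ln (a%:R : R).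
Proof. by move=> a0; rewrite natrX lnXn ?ltr0n // mulr_natl. Qed.

Lemma ler_ln_nat (R : realType) (a b : nat) : (0 < a)%N -> (a <= b)%N ->
  ln (a%:R : R) <= ln (b%:R : R).
Proof.
move=> a0 ab; rewrite ler_ln ?posrE ?ltr0n ?ler_nat //; exact: leq_trans ab.
Qed.

Lemma ln_nat_ge (R : realType) (M : R) : exists N : nat, forall n : nat, (N <= n)%N ->
  (0 < n)%N /\ M <= ln (n%:R : R).
Proof.
exists (Num.bound (expR M)) => n Nn.
have lt : expR M < n%:R.
  apply: lt_le_trans (archi_boundP (expR_ge0 M)) _; by rewrite ler_nat.
have n0 : (0 : R) < n%:R := lt_trans (expR_gt0 M) lt.
split; first by rewrite -(ltr0n R).
by rewrite -[M]expRK ler_ln ?posrE ?expR_gt0 // ltW.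
Qed.

(** Writing x = y^4 with y >= 4 gives ln x = 4 ln y <= 4y <= y^2; hence 256 = 4^4. *)
Lemma ln_le_sqrt (R : realType) (x : R) : 256 <= x -> ln x <= Num.sqrt x.
Proof.
move=> x256; have x0 : 0 < x by lra.
pose y := Num.sqrt (Num.sqrt x).
have y0 : 0 <= y := sqrtr_ge0 _.
have ey2 : y ^+ 2 = Num.sqrt x by rewrite sqr_sqrtr ?sqrtr_ge0.
have ey4 : y ^+ 4 = x by rewrite (exprM y 2 2) ey2 sqr_sqrtr // ltW.
have y4 : 4 <= y.
  rewrite leNgt; apply/negP => ylt.
  have : y ^+ 4 < 4 ^+ 4 by rewrite ltrXn2r.
  by rewrite ey4; lra.
rewrite -ey2 -[in ln x]ey4 lnXn; last lra.
have : ln y < y by apply: ln_sublinear; lra.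
rewrite -mulr_natl; nra.
Qed.

Lemma ln_kmax_le (R : realType) (n j : nat) : (0 < n)%N -> (1 < j)%N ->
  (2 ^ (tetr2 j).+1 <= kmax n)%N ->
  (tetr2 j)%:R * ln ((kmax n)%:R : R) <=
    (tetr2 j).+1%:R * ln 2 + ln (n%:R : R).
Proof.
move=> n0 j1 kb; have [k0 _ _] := kmaxP n.
rewrite -!ln_natX // -lnM ?posrE ?ltr0n ?expn_gt0 // -natrM.
by apply: ler_ln_nat; rewrite ?expn_gt0 ?k0 // kmax_exp_le.
Qed.

Lemma kmax_general_bound (R : realType) : exists N : nat, forall n : nat, (N <= n)%N ->
  ln ((kmax n)%:R : R) <= 2 * ln (n%:R : R) / ln (ln (n%:R : R)).
Proof.
have l1 := ln2_lt1 R; have l0 := ln2_gt0 R.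
(* The 16 yields L >= 256 from L >= C^2; the other summand yields q(1 - ln 2) > 1 once q >= sqrt L
   >= C. *)
pose C : R := 16 + (1 - ln 2)^-1.
have iC : 0 < (1 - ln 2 : R)^-1 by rewrite invr_gt0; lra.
have [N HN] := ln_nat_ge (C ^+ 2); exists N => n /HN[n0].
set L := ln n%:R => CL.
have C16 : 16 <= C by rewrite /C; lra.
have L256 : 256 <= L by nra.
have sC : C <= Num.sqrt L.
  by rewrite -[C]ger0_norm -?sqrtr_sqr ?ler_sqrt; nra.
have lnL0 : 0 < ln L by rewrite ln_gt0; lra.
pose q := L / ln L.
have qL : q * ln L = L by rewrite /q divfK // gt_eqF.
have sq : Num.sqrt L <= q.
  rewrite ler_pdivlMr // -[leRHS]sqr_sqrtr; last lra.
  by rewrite expr2 ler_wpM2l ?sqrtr_ge0 // ln_le_sqrt.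
rewrite -mulrA -/q.
have [k0 _ _] := kmaxP n.
set x := ln (kmax n)%:R.
have [k32|k32] := leqP (2 ^ 5) (kmax n); last first.
  have := ler_ln_nat R k0 (ltnW k32); rewrite ln_natX // -/x; nra.
rewrite leNgt; apply/negP => xq.
have [j j1 /andP[jk kj]] := exists_tetr2_floor k32.
have := ln_kmax_le R n0 j1 jk; rewrite -/x -/L.
have := ler_ln_nat R k0 (ltnW kj); rewrite ln_natX // -/x -[(2 ^ _).+1]addn1.
have b4 : 4 <= (tetr2 j)%:R :> R by rewrite (ler_nat _ 4) tetr2_ge4.
rewrite -[(tetr2 j).+1]addn1 !natrD; move: b4.
set b := (tetr2 j)%:R; set B := (2 ^ _)%:R => b4 xB bx.
(* From 2q < x <= (B + 1) ln 2. Then B > sqrt L, so b ln 2 = ln B >= (ln L)/2. *)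
have qB : q < B by nra.
have lB : ln B = b * ln 2 by rewrite /B ln_natX.
have : ln (Num.sqrt L) <= ln B by rewrite ler_ln ?posrE; lra.
have -> : ln (Num.sqrt L) = ln L / 2.
  have s0 : 0 < Num.sqrt L by lra.
  rewrite -[in RHS](@sqr_sqrtr _ L); last lra.
  by rewrite lnXn // -mulr_natl; field.
rewrite lB => lLb.
(* With L <= 2qb ln 2, the bound bx <= (b + 1) ln 2 + L gives 2qb(1 - ln 2) < (b + 1) ln 2, which
   contradicts q(1 - ln 2) > 1. *)
have qC : C * (1 - ln 2) <= q * (1 - ln 2) by apply: ler_wpM2r; lra.
have eC : C * (1 - ln 2) = 16 * (1 - ln 2) + 1.
  by rewrite /C mulrDl mulVf //; lra.
have : b * (2 * q) < b * x by rewrite ltr_pM2l; lra.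
have : L <= 2 * q * (b * ln 2) by rewrite -{1}qL; nra.
nra.
Qed.

(** With b = 2^^(m-1), n is 2^(b^2), so sqrt(ln n) = b sqrt(ln 2), while k <= 2^(b+2). *)
Lemma kmax_tower_bound (R : realType) : exists N : nat, forall n m : nat, (N <= n)%N ->
  (2 <= m)%N -> n = (tetr2 m ^ tetr2 (m - 1))%N ->
  ln ((kmax n)%:R : R) <= Num.sqrt (ln (n%:R : R)).
Proof.
have l1 := ln2_lt1 R; have l0 := ln2_gt0 R.
pose s : R := Num.sqrt (ln 2).
have s0 : 0 < s by rewrite sqrtr_gt0.
have es : s ^+ 2 = ln 2 by rewrite sqr_sqrtr // ltW.
have s1 : s < 1 by nra.
(* Chosen so that b >= C gives b(1 - s) >= 2, whence (b + 2) s^2 <= b s. *)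
pose C : R := 4 + 2 / (1 - s).
have iC : 0 < 2 / (1 - s) by rewrite divr_gt0; lra.
have [N HN] := ln_nat_ge (C ^+ 2); exists N => n m /HN[n0 CL].
case: m => [|[|m]] // _; rewrite subn1 /= => en.
set b := (2 ^ tetr2 m)%N in en.
have eL : ln (n%:R : R) = (b%:R * s) ^+ 2.
  by rewrite en !ln_natX ?expn_gt0 // exprMn es; ring.
have bs0 : 0 <= b%:R * s by rewrite mulr_ge0 // ltW.
rewrite eL sqrtr_sqr ger0_norm //.
have bC : C <= b%:R.
  have : C <= b%:R * s by move: CL; rewrite eL ler_sqr ?nnegrE // /C; lra.
  move=> /le_trans; apply; rewrite ler_piMr //; exact: ltW.
have b4 : (4 <= b)%N by rewrite -(ler_nat R) /C in bC *; lra.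
(* For m = 0 the value of [b] would be 2. *)
have m1 : (1 < m.+1)%N.
  by case: (m) @b b4 {en eL bs0 bC}.
have [k0 _ _] := kmaxP n.
have : (kmax n <= 2 ^ (b + 2))%N.
  have [kb|kb] := leqP (2 ^ b.+1) (kmax n); last first.
    by apply: leq_trans (ltnW kb) _; rewrite leq_exp2l //; lia.
  have := kmax_exp_le m1 kb; rewrite -/(tetr2 m.+1) /= -/b.
  rewrite {2}en -expnM -expnD => le.
  rewrite -(@leq_exp2r _ _ b); last lia.
  (* On exponents of 2: b + 1 + b^2 <= (b + 2)b. *)
  apply: leq_trans le _; rewrite -expnM leq_exp2l //; nia.
move=> /(ler_ln_nat R k0); rewrite ln_natX // natrD -es.
have : C * (1 - s) <= b%:R * (1 - s) by apply: ler_wpM2r; lra.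
have -> : C * (1 - s) = 4 * (1 - s) + 2.
  by rewrite /C mulrDl divfK // gt_eqF // subr_gt0.
nra.
Qed.

Theorem theorem6 (R : realType) :
  (exists N : nat, forall n : nat, (N <= n)%N ->
     ln ((kmax n)%:R : R) <= 2 * ln (n%:R : R) / ln (ln (n%:R : R)))
  /\
  (exists N : nat, forall n m : nat, (N <= n)%N -> (2 <= m)%N ->
     n = (tetr2 m ^ tetr2 (m - 1))%N ->
     ln ((kmax n)%:R : R) <= Num.sqrt (ln (n%:R : R))).
Proof.
by split; [exact: kmax_general_bound | exact: kmax_tower_bound].
Qed.
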